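(* The category $\mathbf{mQ}$ of mq-spaces and mq-functions is naturally equivalent to the dual of the category $\mathbf{M}$ of monadic distributive lattices (m-lattices) and their homomorphisms.
   Context: An m-lattice is a triple $(L,\triangle,\nabla)$ where $L$ is a bounded distributive lattice and $\triangle,\nabla$ are unary operations satisfying: $\nabla 0=0$, $x\wedge\nabla x=x$, $\nabla(x\wedge\nabla y)=\nabla x\wedge\nabla y$, $\nabla(x\vee y)=\nabla x\vee\nabla y$, $\nabla\nabla x=\nabla x$, $\triangle 1=1$, $x\wedge\triangle x=\triangle x$, $\triangle(x\wedge y)=\triangle x\wedge\triangle y$, $\triangle\triangle x=\triangle x$, $\nabla\triangle x=\triangle x$, $\triangle\nabla x=\nabla x$. Morphisms of $\mathbf{M}$ are bounded lattice homomorphisms preserving $\triangle$ and $\nabla$. Notation: for a relation $R$ on $X$ and $Z\subseteq X$, $R(Z)=\{y:(x,y)\in R\text{ for some }x\in Z\}$, $R(x)=R(\{x\})$. In a poset, $(Y]=\{x: x\le y \text{ for some } y\in Y\}$, $[Y)=\{x: y\le x\text{ for some }y\in Y\}$, $[x)=[\{x\})$. A Priestley space is a compact topological space with a partial order which is totally order-disconnected (if $x\not\le y$ there is a clopen increasing $U$ with $x\in U$, $y\notin U$); $D(X)$ denotes the set of clopen increasing subsets of $X$. A q-space is a pair $(X,E)$ with $X$ a Priestley space and $E$ an equivalence relation on $X$ such that $E(U)\in D(X)$ for all $U\in D(X)$ and every $E$-equivalence class is closed. A q-function $f:(X_1,E_1)\to(X_2,E_2)$ is an order-preserving continuous map with $E_1(f^{-1}(U))=f^{-1}(E_2(U))$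 for all $U\in D(X_2)$. An mq-space is a q-space $(X,E)$ such that (mq1) if $(x,y)\in E$ and $y\le z$ then there is $w$ with $x\le w$ and $(w,z)\in E$; (mq2) for every $V\in D(X)$, $(E(X\setminus V)]$ is clopen. An mq-function between mq-spaces is a q-function $f$ with $(E_1(f^{-1}(X_2\setminus V))]=f^{-1}((E_2(X_2\setminus V)])$ for all $V\in D(X_2)$. *)

(* Defs.v *)
From HB Require Import structures.
From mathcomp Require Import all_boot all_order.
From mathcomp Require Import boolp classical_sets filter topology.

Set Implicit Arguments.
Unset Strict Implicit.
Unset Printing Implicit Defensive.

Local Open Scope classical_set_scope.

Record category := Category {
  ob :> Type;
  hom : ob -> ob -> Type;
  idm : forall a, hom a a;
  comp : forall a b c, hom b c -> hom a b -> hom a c;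
  comp_idl : forall a b (f : hom a b), comp (idm b) f = f;
  comp_idr : forall a b (f : hom a b), comp f (idm a) = f;
  comp_assoc : forall a b c d (h : hom c d) (g : hom b c) (f : hom a b),
    comp h (comp g f) = comp (comp h g) f
}.

Arguments hom {_} _ _.
Arguments idm {_} _.
Arguments comp {_ _ _ _} _ _.

Definition dual_category (C : category) : category :=
  @Category C (fun a b => hom b a) (fun a => idm a)
    (fun a b c g f => comp f g)
    (fun a b f => comp_idr f)
    (fun a b f => comp_idl f)
    (fun a b c d h g f => esym (comp_assoc f g h)).

Record functor (C D : category) := Functor {
  fobj :> C -> D;
  fmap : forall a b, hom a b -> hom (fobj a) (fobj b);
  fmap_id : forall a, fmap (idm a) = idm (fobj a);
  fmap_comp : forall a b c (g : hom b c) (f : hom a b),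
    fmap (comp g f) = comp (fmap g) (fmap f)
}.

Definition id_functor (C : category) : functor C C :=
  @Functor C C id (fun _ _ f => f) (fun _ => erefl) (fun _ _ _ _ _ => erefl).

Section comp_functor.
Variables (C D E : category) (G : functor D E) (F : functor C D).

Let map a b (f : hom a b) : hom (G (F a)) (G (F b)) := fmap G (fmap F f).

Let map_id a : map (idm a) = idm (G (F a)).
Proof. by rewrite /map !fmap_id. Qed.

Let map_comp a b c (g : hom b c) (f : hom a b) :
  map (comp g f) = comp (map g) (map f).
Proof. by rewrite /map !fmap_comp. Qed.

Definition comp_functor : functor C E :=
  @Functor C E (fun a => G (F a)) map map_id map_comp.
End comp_functor.

Definition is_iso (C : category) (a b : C) (f : hom a b) : Prop :=
  exists g : hom b a, comp g f = idm a /\ comp f g = idm b.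

Definition naturally_isomorphic (C D : category) (F G : functor C D) : Prop :=
  exists eta : forall a, hom (F a) (G a),
    (forall a b (f : hom a b),
       comp (eta b) (fmap F f) = comp (fmap G f) (eta a)) /\
    (forall a, is_iso (eta a)).

Definition equivalent_categories (C D : category) : Prop :=
  exists (F : functor C D) (G : functor D C),
    naturally_isomorphic (comp_functor G F) (id_functor C) /\
    naturally_isomorphic (comp_functor F G) (id_functor D).

Section mlattice.
Local Open Scope order_scope.

(* [tri] and [nab] are the operators written as a triangle and a nabla. *)
Record is_mlattice (d : Order.disp_t) (L : tbDistrLatticeType d)
    (tri nab : L -> L) : Prop := IsMLattice {
  nab0 : nab \bot = \bot;
  meet_nab : forall x, x `&` nab x = x;
  nab_meet : forall x y, nab (x `&` nab y) = nab x `&` nab y;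
  nab_join : forall x y, nab (x `|` y) = nab x `|` nab y;
  nab_nab : forall x, nab (nab x) = nab x;
  tri1 : tri \top = \top;
  meet_tri : forall x, x `&` tri x = tri x;
  tri_meet : forall x y, tri (x `&` y) = tri x `&` tri y;
  tri_tri : forall x, tri (tri x) = tri x;
  nab_tri : forall x, nab (tri x) = tri x;
  tri_nab : forall x, tri (nab x) = nab x
}.

(* Displays only steer the printing of order notations, hence are irrelevant
   to isomorphism of objects; \bot = \top is allowed. *)
Record mlattice := MLattice {
  ml_disp : Order.disp_t;
  ml_lattice :> tbDistrLatticeType ml_disp;
  ml_tri : ml_lattice -> ml_lattice;
  ml_nab : ml_lattice -> ml_lattice;
  ml_axioms : is_mlattice ml_tri ml_nab
}.

(* The library's {tblmorphism L1 -> L2} cannot be used here: it only asks for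
   the preservation of \bot and \top, not of meets and joins. *)
Record is_mlattice_hom (L1 L2 : mlattice) (f : L1 -> L2) : Prop :=
  IsMLatticeHom {
  mlhom_meet : Order.meet_morphism f;
  mlhom_join : Order.join_morphism f;
  mlhom_bot : f \bot = \bot;
  mlhom_top : f \top = \top;
  mlhom_tri : forall x, f (ml_tri x) = ml_tri (f x);
  mlhom_nab : forall x, f (ml_nab x) = ml_nab (f x)
}.

Record mlattice_hom (L1 L2 : mlattice) := MLatticeHom {
  mlhom_fun :> L1 -> L2;
  mlhom_axioms : is_mlattice_hom mlhom_fun
}.

Lemma mlattice_hom_eq (L1 L2 : mlattice) (f g : mlattice_hom L1 L2) :
  mlhom_fun f = mlhom_fun g -> f = g.
Proof.
case: f g => [f hf] [g hg] /= fg; move: hf; rewrite fg => hf.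
by congr MLatticeHom; exact: Prop_irrelevance.
Qed.

Lemma is_mlattice_hom_id (L : mlattice) : is_mlattice_hom (@id L).
Proof. by split. Qed.

Lemma is_mlattice_hom_comp (L1 L2 L3 : mlattice)
    (g : mlattice_hom L2 L3) (f : mlattice_hom L1 L2) :
  is_mlattice_hom (g \o f).
Proof.
case: g f => [g [gI gU g0 g1 gt gn]] [f [fI fU f0 f1 ft fn]].
by split => [x y|x y|||x|x] /=;
  rewrite ?fI ?gI ?fU ?gU ?f0 ?g0 ?f1 ?g1 ?ft ?gt ?fn ?gn.
Qed.

Definition mlattice_id (L : mlattice) : mlattice_hom L L :=
  MLatticeHom (is_mlattice_hom_id L).

Definition mlattice_comp (L1 L2 L3 : mlattice)
    (g : mlattice_hom L2 L3) (f : mlattice_hom L1 L2) : mlattice_hom L1 L3 :=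
  MLatticeHom (is_mlattice_hom_comp g f).

Definition M : category :=
  @Category mlattice mlattice_hom mlattice_id mlattice_comp
    (fun _ L f => @mlattice_hom_eq _ _ (mlattice_comp (mlattice_id L) f) f erefl)
    (fun L _ f => @mlattice_hom_eq _ _ (mlattice_comp f (mlattice_id L)) f erefl)
    (fun _ _ _ _ h g f =>
       @mlattice_hom_eq _ _ (mlattice_comp h (mlattice_comp g f))
         (mlattice_comp (mlattice_comp h g) f) erefl).

End mlattice.

Definition rel_image (X : Type) (E : X -> X -> Prop) (Z : set X) : set X :=
  [set y | exists2 x, Z x & E x y].

Section priestley.
Variables (d : Order.disp_t) (X : POrderedTopological.type d).

Definition down_closure (Y : set X) : set X :=
  [set x | exists2 y, Y y & (x <= y)%O].

Definition increasing_set (U : set X) : Prop :=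
  forall x y, (x <= y)%O -> U x -> U y.

Definition clopen_increasing : set (set X) :=
  [set U | clopen U /\ increasing_set U].

(* POrderedTopological imposes no compatibility between topology and order. *)
Record is_priestley : Prop := IsPriestley {
  priestley_compact : compact [set: X];
  priestley_separated : forall x y, ~ (x <= y)%O ->
    exists U, [/\ clopen_increasing U, U x & ~ U y]
}.

Record is_qspace (E : X -> X -> Prop) : Prop := IsQSpace {
  qspace_priestley : is_priestley;
  qspace_equiv : RelationClasses.Equivalence E;
  qspace_image : forall U,
    clopen_increasing U -> clopen_increasing (rel_image E U);
  qspace_closed : forall x, closed (rel_image E [set x])
}.

Record is_mqspace (E : X -> X -> Prop) : Prop := IsMQSpace {
  mqspace_qspace : is_qspace E;
  mq1 : forall x y z, E x y -> (y <= z)%O -> exists2 w, (x <= w)%O & E w z;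
  mq2 : forall V, clopen_increasing V ->
    clopen (down_closure (rel_image E (~` V)))
}.

End priestley.

Record mqspace := MQSpace {
  mq_disp : Order.disp_t;
  mq_space :> POrderedTopological.type mq_disp;
  mq_rel : mq_space -> mq_space -> Prop;
  mq_axioms : is_mqspace mq_rel
}.

Record is_qfunction (d1 d2 : Order.disp_t)
    (X1 : POrderedTopological.type d1) (E1 : X1 -> X1 -> Prop)
    (X2 : POrderedTopological.type d2) (E2 : X2 -> X2 -> Prop)
    (f : X1 -> X2) : Prop := IsQFunction {
  qfun_monotone : {homo f : x y / (x <= y)%O};
  qfun_continuous : continuous f;
  qfun_image : forall U, clopen_increasing U ->
    rel_image E1 (f @^-1` U) = f @^-1` (rel_image E2 U)
}.

Record is_mqfunction (d1 d2 : Order.disp_t)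
    (X1 : POrderedTopological.type d1) (E1 : X1 -> X1 -> Prop)
    (X2 : POrderedTopological.type d2) (E2 : X2 -> X2 -> Prop)
    (f : X1 -> X2) : Prop := IsMQFunction {
  mqfun_qfun : is_qfunction E1 E2 f;
  mqfun_down : forall V, clopen_increasing V ->
    down_closure (rel_image E1 (f @^-1` (~` V))) =
    f @^-1` (down_closure (rel_image E2 (~` V)))
}.

Record mqfunction (X1 X2 : mqspace) := MQFunction {
  mqfun_fun :> X1 -> X2;
  mqfun_axioms : is_mqfunction (@mq_rel X1) (@mq_rel X2) mqfun_fun
}.

Lemma mqfunction_eq (X1 X2 : mqspace) (f g : mqfunction X1 X2) :
  mqfun_fun f = mqfun_fun g -> f = g.
Proof.
case: f g => [f hf] [g hg] /= fg; move: hf; rewrite fg => hf.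
by congr MQFunction; exact: Prop_irrelevance.
Qed.

Lemma clopen_increasing_preimage (d1 d2 : Order.disp_t)
    (X1 : POrderedTopological.type d1) (X2 : POrderedTopological.type d2)
    (f : X1 -> X2) (U : set X2) :
  {homo f : x y / (x <= y)%O} -> continuous f ->
  clopen_increasing U -> clopen_increasing (f @^-1` U).
Proof.
move=> fle fct [[Uo Uc] Ui]; split; last by move=> x y /fle; exact: Ui.
by split; [move/continuousP: fct; apply | move/continuous_closedP: fct; apply].
Qed.

Lemma is_mqfunction_id (X : mqspace) :
  is_mqfunction (@mq_rel X) (@mq_rel X) id.
Proof. by split=> //; split=> // x; exact: cvg_id. Qed.

Lemma is_mqfunction_comp (X1 X2 X3 : mqspace)
    (g : mqfunction X2 X3) (f : mqfunction X1 X2) :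
  is_mqfunction (@mq_rel X1) (@mq_rel X3) (g \o f).
Proof.
case: g f => [g [[gle gct gE] gD]] [f [[fle fct fE] fD]] /=.
have gU := clopen_increasing_preimage gle gct.
split; first split.
- by move=> x y xy; exact/gle/fle.
- by move=> x; apply: continuous_comp; [exact: fct | exact: gct].
- by move=> U DU; apply: etrans (fE _ (gU _ DU)) _; rewrite gE.
- by move=> V DV; apply: etrans (fD _ (gU _ DV)) _; rewrite preimage_setC gD.
Qed.

Definition mqfunction_id (X : mqspace) : mqfunction X X :=
  MQFunction (is_mqfunction_id X).

Definition mqfunction_comp (X1 X2 X3 : mqspace)
    (g : mqfunction X2 X3) (f : mqfunction X1 X2) : mqfunction X1 X3 :=
  MQFunction (is_mqfunction_comp g f).

Definition mQ : category :=
  @Category mqspace mqfunction mqfunction_id mqfunction_comp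
    (fun _ X f => @mqfunction_eq _ _ (mqfunction_comp (mqfunction_id X) f) f erefl)
    (fun X _ f => @mqfunction_eq _ _ (mqfunction_comp f (mqfunction_id X)) f erefl)
    (fun _ _ _ _ h g f =>
       @mqfunction_eq _ _ (mqfunction_comp h (mqfunction_comp g f))
         (mqfunction_comp (mqfunction_comp h g) f) erefl).

(* Main.v *)
(** An m-lattice L is sent to its space of prime filters, with P E Q when P and
    Q contain the same elements of the form [nab a]; an mq-space X is sent to
    its lattice D(X), with nab U = E(U) and tri V = X \ (E(X \ V)].  Everything
    on the lattice side follows from one extension property: if F is a filter
    and R a prime filter containing nab p for all p in F, then some prime
    filter Q containing F satisfies Q E R, because a relation
    p /\ nab r <= nab s entails nab p /\ nab r <= nab s.  On the topological
    side, the only fact beyond Priestley duality is that E is determined by the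
    sets E(U) with U in D(X), which rests on closed sets having maximal
    elements. *)
From HB Require Import structures.
From mathcomp Require Import all_boot all_order.
From mathcomp Require Import boolp classical_sets filter topology.
Require Import Defs.

Set Implicit Arguments.
Unset Strict Implicit.
Unset Printing Implicit Defensive.
Import Order.TTheory.
Local Open Scope order_scope.
Local Open Scope classical_set_scope.

(** * Filters, ideals and prime separation in distributive lattices *)

Section LatticeFilters.
Variables (d : Order.disp_t) (L : tbDistrLatticeType d).

Record lattice_filter (F : set L) : Prop := LatticeFilter {
  filter_top : F \top;
  filter_up : forall x y, x <= y -> F x -> F y;
  filter_meet : forall x y, F x -> F y -> F (x `&` y)%O
}.

Record lattice_ideal (I : set L) : Prop := LatticeIdeal {
  ideal_bot : I \bot;
  ideal_down : forall x y, x <= y -> I y -> I x;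
  ideal_join : forall x y, I x -> I y -> I (x `|` y)%O
}.

Record is_prime_filter (P : set L) : Prop := IsPrimeFilter {
  prime_is_filter : lattice_filter P;
  prime_bot : ~ P \bot;
  prime_join : forall x y, P (x `|` y)%O -> P x \/ P y
}.

Lemma principal_filter (a : L) : lattice_filter [set x | a <= x].
Proof.
split=> [|x y xy ax|x y ax ay]; first exact: lex1.
  exact: le_trans ax xy.
by rewrite /= lexI; apply/andP; split.
Qed.

Lemma principal_ideal (a : L) : lattice_ideal [set x | x <= a].
Proof.
split=> [|x y xy ya|x y xa ya]; first exact: le0x.
  exact: le_trans xy ya.
by rewrite /= leUx; apply/andP; split.
Qed.

Lemma filter_adjoin (F : set L) (a : L) : lattice_filter F ->
  lattice_filter [set z | exists2 p, F p & (p `&` a <= z)%O].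
Proof.
move=> [F1 Fu Fm]; split=> [|x y xy [p Fp px]|x y [p Fp px] [q Fq qy]].
- by exists \top => //; exact: lex1.
- by exists p => //; exact: le_trans xy.
- exists (p `&` q)%O; first exact: Fm.
  by rewrite lexI (le_trans _ px) ?(le_trans _ qy) // leI2 ?leIl ?leIr.
Qed.

(** Zorn's lemma gives a maximal filter among those that contain F and avoid I. It is prime: if x
    and y were both outside, adjoining either one would produce an element of I, and distributivity
    would then put into I an element of the filter lying below the join of x and y. *)
Lemma prime_filter_separation (F I : set L) :
  lattice_filter F -> lattice_ideal I -> (forall x, F x -> ~ I x) ->
  exists P, [/\ is_prime_filter P, F `<=` P & forall x, P x -> ~ I x].
Proof.
move=> Ff [I0 Id Ij] FI.
(* Adding F to the sets in the chain takes care of the empty chain. *)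
pose Q (A : set L) :=
  lattice_filter (F `|` A) /\ forall x, (F `|` A) x -> ~ I x.
have [C CQ Ctot|A [[Af AI] Amax]] := @Zorn_bigcup L Q.
  split; last first.
    by move=> x [/FI//|[A CA Ax]]; apply: (CQ A CA).2; right.
  split; first by left; exact: filter_top Ff.
  - move=> x y xy [Fx|[A CA Ax]]; first by left; exact: filter_up Fx.
    have [|?|?] := filter_up (CQ A CA).1 xy; [by right|by left|].
    by right; exists A.
  - move=> x y [Fx|[A CA Ax]] [Fy|[B CB By]].
    + by left; exact: filter_meet.
    + have [||?|?] := @filter_meet _ (CQ B CB).1 x y;
        [by left|by right|by left|by right; exists B].
    + have [||?|?] := @filter_meet _ (CQ A CA).1 x y;
        [by right|by left|by left|by right; exists A].
    + have [AB|BA] := Ctot _ _ CA CB.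
      * have [||?|?] := @filter_meet _ (CQ B CB).1 x y;
          [by right; exact: AB|by right|by left|by right; exists B].
      * have [||?|?] := @filter_meet _ (CQ A CA).1 x y;
          [by right|by right; exact: BA|by left|by right; exists A].
exists (F `|` A); split=> //.
(* Adjoining an outside element a gives a strictly larger filter, so by maximality that filter meets
   I. *)
have adj a : ~ (F `|` A) a -> exists2 p, (F `|` A) p & I (p `&` a)%O.
  move=> Aa; pose G := [set z | exists2 p, (F `|` A) p & (p `&` a <= z)%O].
  have AG : F `|` A `<=` G by move=> z Az; exists z => //; exact: leIl.
  have FG : F `|` G = G by apply/setUidPr => z Fz; apply: AG; left.
  have /Amax : A `<` G.
    split=> [|GA]; first by move=> z Az; apply: AG; right.
    by apply: Aa; right; apply: GA; exists \top;
      [exact: filter_top Af|exact: leIr].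
  rewrite /Q FG => /not_andP[|/existsNP[z /not_implyP[[p Ap pz] /contrapT Iz]]].
    by case; exact: filter_adjoin.
  by exists p => //; exact: Id Iz.
split=> // [A0|x y Axy]; first exact: AI A0 I0.
apply: contrapT => /not_orP[/adj[p Ap Ipx] /adj[q Aq Iqy]].
apply: (AI ((p `&` q) `&` (x `|` y))%O).
  by apply: filter_meet => //; exact: filter_meet.
by apply: Id (Ij _ _ Ipx Iqy); rewrite meetUr leU2 // leI2 ?leIl ?leIr.
Qed.

End LatticeFilters.

(** * The Priestley space of prime filters *)

Section PrimeFilterSpace.
Variables (d : Order.disp_t) (L : tbDistrLatticeType d).

Record prime_filter := PrimeFilter {
  pf_set : set L;
  pf_prime : is_prime_filter pf_set
}.

HB.instance Definition _ := gen_eqMixin prime_filter.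
HB.instance Definition _ := gen_choiceMixin prime_filter.

Lemma prime_filter_eq (P Q : prime_filter) : pf_set P = pf_set Q -> P = Q.
Proof.
case: P Q => [P hP] [Q hQ] /= PQ; move: hP; rewrite PQ => hP.
by congr PrimeFilter; exact: Prop_irrelevance.
Qed.

Definition pf_le (P Q : prime_filter) : bool := `[< pf_set P `<=` pf_set Q >].

Lemma pf_le_refl : reflexive pf_le. Proof. by move=> P; apply/asboolP. Qed.

Lemma pf_le_anti : antisymmetric pf_le.
Proof.
move=> P Q /andP[/asboolP PQ /asboolP QP].
by apply: prime_filter_eq; apply/seteqP.
Qed.

Lemma pf_le_trans : transitive pf_le.
Proof.
by move=> P Q R /asboolP PQ /asboolP QR; apply/asboolP; exact: subset_trans QR.
Qed.

HB.instance Definition _ := Order.Le_isPOrder.Build d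
  prime_filter pf_le_refl pf_le_anti pf_le_trans.

Lemma pf_up (P : prime_filter) (x y : L) : x <= y -> pf_set P x -> pf_set P y.
Proof.
by move=> xy; exact: (filter_up (prime_is_filter (pf_prime P)) xy).
Qed.

Definition stone (a : L) : set prime_filter := [set P | pf_set P a].

Lemma stoneI a b : stone (a `&` b)%O = stone a `&` stone b.
Proof.
apply/seteqP; split=> P /=; rewrite /stone /=;
  have [[_ Pu Pm] _ _] := pf_prime P.
  by move=> ab; split; apply: Pu ab; [exact: leIl|exact: leIr].
by case; exact: Pm.
Qed.

Lemma stoneU a b : stone (a `|` b)%O = stone a `|` stone b.
Proof.
apply/seteqP; split=> P /=; rewrite /stone /=;
  have [[_ Pu _] _ Pj] := pf_prime P.
  exact: Pj.
by case; apply: Pu; [exact: leUl|exact: leUr].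
Qed.

Lemma stone1 : stone \top = setT.
Proof.
by rewrite -subTset => P _; exact: filter_top (prime_is_filter (pf_prime P)).
Qed.

Lemma stone0 : stone \bot = set0.
Proof. by rewrite -subset0 => P /(prime_bot (pf_prime P)). Qed.

(** If a is not below b, the principal filter of a and the principal ideal of b are disjoint, and a
    prime filter separating them contradicts the inclusion. This is what makes the Stone map
    injective. *)
Lemma stone_le (a b : L) : stone a `<=` stone b -> a <= b.
Proof.
move=> ab; apply: contrapT => nab.
have [||x ax xb|P [hP aP Pb]] := @prime_filter_separation _ L
  [set x | a <= x] [set x | x <= b].
- exact: principal_filter.
- exact: principal_ideal.
- exact: nab (le_trans ax xb).
exact: Pb b (ab (PrimeFilter hP) (aP a (lexx a))) (lexx b).
Qed.

(** The topology generated by the Stone sets and their complements. The differences of two Stone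
    sets already form a base, since they are closed under binary intersection. *)
Definition pf_open (O : set prime_filter) : Prop := forall P, O P ->
  exists a b, [/\ stone a P, ~ stone b P & stone a `\` stone b `<=` O].

Lemma pf_openT : pf_open setT.
Proof.
by move=> P _; exists \top, \bot; split=> //; rewrite ?stone1 ?stone0.
Qed.

Lemma pf_openI : setI_closed pf_open.
Proof.
move=> A B oA oB P [/oA[a [b [Pa Pb abA]]] /oB[a' [b' [Pa' Pb' abB]]]].
exists (a `&` a')%O, (b `|` b')%O; rewrite stoneI stoneU.
split=> //; first by case.
by move=> Q [[Qa Qa'] /not_orP[Qb Qb']]; split; [exact: abA|exact: abB].
Qed.

Lemma pf_open_bigU (I : Type) (f : I -> set prime_filter) :
  (forall i, pf_open (f i)) -> pf_open (\bigcup_i f i).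
Proof.
move=> fo P [i _ /fo[a [b [Pa Pb abf]]]]; exists a, b; split=> //.
by move=> Q /abf; exists i.
Qed.

HB.instance Definition _ :=
  isOpenTopological.Build prime_filter pf_openT pf_openI pf_open_bigU.

Lemma pf_leP (P Q : prime_filter) : reflect (pf_set P `<=` pf_set Q) (P <= Q).
Proof. exact: asboolP. Qed.

Lemma pf_openE (O : set prime_filter) : open O = pf_open O.
Proof. by []. Qed.

Lemma stone_clopen a : clopen (stone a).
Proof.
split.
- rewrite pf_openE => P Pa; exists a, \bot; by split; rewrite ?stone0 ?setD0.
- rewrite -openC pf_openE => P Pa; exists \top, a.
  by split; rewrite ?stone1 ?setTD.
Qed.

Lemma stone_clopen_increasing a : clopen_increasing (stone a).
Proof. by split; [exact: stone_clopen|move=> P Q /pf_leP; apply]. Qed.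

(** An ultrafilter F converges to the set of all a with [stone a] in F. This set is a prime filter
    because an ultrafilter contains each set or its complement. *)
Lemma prime_filter_compact : compact [set: prime_filter].
Proof.
rewrite compact_ultra => F UF _.
have FF : ProperFilter F := @ultra_proper _ F UF.
have Fs (A B : set prime_filter) : A `<=` B -> F A -> F B.
  by move=> AB; exact: filterS.
have hP : is_prime_filter [set a | F (stone a)].
  split; first split.
  - by rewrite /= stone1; exact: filterT.
  - by move=> x y xy; apply: Fs => P; exact: pf_up.
  - by move=> x y Fx Fy /=; rewrite stoneI; exact: filterI.
  - by rewrite /= stone0; exact: filter_not_empty.
  - move=> x y; rewrite /= stoneU => Fxy.
    have [Fx|Fx] := in_ultra_setVsetC (stone x) UF; first by left.
    by right; apply: Fs (filterI Fxy Fx) => P [[]].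
exists (PrimeFilter hP); split=> // A [B [Bo BP BA]].
have [a [b [Pa Pb abB]]] := Bo _ BP.
apply: (Fs _ _ BA); apply: (Fs _ _ abB); apply: filterI => //.
by have [/Pb|] := in_ultra_setVsetC (stone b) UF.
Qed.

Lemma prime_filter_priestley : is_priestley prime_filter.
Proof.
split; first exact: prime_filter_compact.
move=> P Q PQ; have /existsNP[a /not_implyP[Pa Qa]] :
  ~ (pf_set P `<=` pf_set Q) by move=> /pf_leP.
exists (stone a).
by split=> //; exact: stone_clopen_increasing.
Qed.

End PrimeFilterSpace.

(** Finite intersection property for a down-directed family: its members generate a proper filter,
    and a cluster point of that filter lies in each closed member. All compactness arguments on
    Priestley spaces below take this form. *)
Lemma compact_directed (X : topologicalType) (I : Type) (D : set I)
    (B : I -> set X) :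
  compact [set: X] -> (exists i, D i) ->
  (forall i j, D i -> D j -> exists2 k, D k & B k `<=` B i `&` B j) ->
  (forall i, D i -> closed (B i)) -> (forall i, D i -> B i !=set0) ->
  exists x, forall i, D i -> B i x.
Proof.
move=> Xc D0 Bdir Bcl B0.
have FB := filter_from_proper (filter_from_filter D0 Bdir) B0.
have [x [_ xF]] := Xc _ FB filterT.
exists x => i Di; apply: Bcl => // A; apply: xF.
by exists i.
Qed.

Lemma stone_surj (d : Order.disp_t) (L : tbDistrLatticeType d)
    (W : set (prime_filter L)) :
  clopen_increasing W -> exists a, W = stone a.
Proof.
move=> [[Wo Wc] Wi].
(* First use of compactness: if no Stone set around P fits inside W, the sets [stone a] minus W have
   a common point Q outside W. It contains every element of P, so it lies above P and hence in the
   increasing set W. *)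
have local P : W P -> exists2 a, stone a P & stone a `<=` W.
  move=> WP; apply: contrapT => nPa.
  have [|||a Pa|Q Q_] := @compact_directed _ _ [set a | stone a P]
    (fun a => stone a `\` W) (@prime_filter_compact _ L).
  - by exists \top; rewrite /= stone1.
  - move=> a b Pa Pb; exists (a `&` b)%O; first by rewrite /= stoneI.
    by rewrite stoneI => Q [[Qa Qb] WQ].
  - move=> a _; apply: closedI; first exact: (stone_clopen a).2.
    by rewrite closedC.
  - apply: contrapT => /nonemptyPn; rewrite setD_eq0 => aW.
    by apply: nPa; exists a.
  - have [|_ []] := Q_ \top; first by rewrite /= stone1.
    by apply: Wi WP; apply/pf_leP => a Pa; have [] := Q_ a Pa.
apply: contrapT => nW.
(* Second use: the Stone sets inside W are directed under joins. If none equals W, some point of W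
   escapes all of them, against [local]. *)
have [|||a aW|Q Q_] := @compact_directed _ _ [set a | stone a `<=` W]
  (fun a => W `\` stone a) (@prime_filter_compact _ L).
- by exists \bot; rewrite /= stone0.
- move=> a b aW bW; exists (a `|` b)%O; first by rewrite /= stoneU subUset.
  by rewrite stoneU => Q [WQ /not_orP[Qa Qb]].
- move=> a _; apply: closedI => //; rewrite closedC.
  exact: (stone_clopen a).1.
- apply: contrapT => /nonemptyPn; rewrite setD_eq0 => Wa.
  by apply: nW; exists a; apply/seteqP.
- have [|WQ _] := Q_ \bot; first by rewrite /= stone0.
  by have [a Qa /Q_[]] := local Q WQ.
Qed.

(** * The bounded distributive lattice of clopen increasing sets *)

Section ClopenIncreasingLattice.
Variables (d : Order.disp_t) (X : POrderedTopological.type d).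

Record upclopen := UpClopen {
  upc_set : set X;
  upcP : clopen_increasing upc_set
}.

HB.instance Definition _ := gen_eqMixin upclopen.
HB.instance Definition _ := gen_choiceMixin upclopen.

Lemma upclopen_eq (U V : upclopen) : upc_set U = upc_set V -> U = V.
Proof.
case: U V => [U hU] [V hV] /= UV; move: hU; rewrite UV => hU.
by congr UpClopen; exact: Prop_irrelevance.
Qed.

Lemma clopen_increasingI (U V : set X) : clopen_increasing U ->
  clopen_increasing V -> clopen_increasing (U `&` V).
Proof.
move=> [Uc Ui] [Vc Vi]; split; first exact: clopenI.
by move=> x y xy [/(Ui _ _ xy) Uy /(Vi _ _ xy) Vy].
Qed.

Lemma clopen_increasingU (U V : set X) : clopen_increasing U ->
  clopen_increasing V -> clopen_increasing (U `|` V).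
Proof.
move=> [Uc Ui] [Vc Vi]; split; first exact: clopenU.
by move=> x y xy [/(Ui _ _ xy) Uy|/(Vi _ _ xy) Vy]; [left|right].
Qed.

Lemma clopen_increasing0 : clopen_increasing (@set0 X).
Proof. by split=> //; exact: clopen0. Qed.

Lemma clopen_increasingT : clopen_increasing [set: X].
Proof. by split=> //; exact: clopenT. Qed.

Definition upc_le (U V : upclopen) : bool := `[< upc_set U `<=` upc_set V >].
Definition upc_lt (U V : upclopen) : bool := (V != U) && upc_le U V.
Definition upc_meet (U V : upclopen) : upclopen :=
  UpClopen (clopen_increasingI (upcP U) (upcP V)).
Definition upc_join (U V : upclopen) : upclopen :=
  UpClopen (clopen_increasingU (upcP U) (upcP V)).
Definition upc_bot : upclopen := UpClopen clopen_increasing0.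
Definition upc_top : upclopen := UpClopen clopen_increasingT.

Lemma upc_le_def U V : upc_le U V = (upc_meet U V == U).
Proof.
apply/asboolP/eqP => [UV|<-]; last exact: subIsetr.
by apply: upclopen_eq; apply/setIidPl.
Qed.

Lemma upc_lt_def U V : upc_lt U V = (V != U) && upc_le U V.
Proof. by []. Qed.

Lemma upc_meetC : commutative upc_meet.
Proof. by move=> U V; apply: upclopen_eq; exact: setIC. Qed.

Lemma upc_joinC : commutative upc_join.
Proof. by move=> U V; apply: upclopen_eq; exact: setUC. Qed.

Lemma upc_meetA : associative upc_meet.
Proof. by move=> U V W; apply: upclopen_eq; exact: setIA. Qed.

Lemma upc_joinA : associative upc_join.
Proof. by move=> U V W; apply: upclopen_eq; exact: setUA. Qed.

Lemma upc_joinKI V U : upc_meet U (upc_join U V) = U.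
Proof. by apply: upclopen_eq; apply/setIidPl; exact: subsetUl. Qed.

Lemma upc_meetKU V U : upc_join U (upc_meet U V) = U.
Proof. by apply: upclopen_eq; apply/setUidPl; exact: subIsetl. Qed.

Lemma upc_meetUl : left_distributive upc_meet upc_join.
Proof. by move=> U V W; apply: upclopen_eq; exact: setIUl. Qed.

Lemma upc_meetxx : idempotent_op upc_meet.
Proof. by move=> U; apply: upclopen_eq; exact: setIid. Qed.

HB.instance Definition _ := Order.isMeetJoinDistrLattice.Build d upclopen
  upc_le_def upc_lt_def upc_meetC upc_joinC upc_meetA upc_joinA
  upc_joinKI upc_meetKU upc_meetUl upc_meetxx.

Lemma upcleP (U V : upclopen) : reflect (upc_set U `<=` upc_set V) (U <= V).
Proof. exact: asboolP. Qed.

Lemma upc_le0x U : upc_bot <= U.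
Proof. by apply/upcleP; exact: sub0set. Qed.

Lemma upc_lex1 U : U <= upc_top.
Proof. by apply/upcleP. Qed.

HB.instance Definition _ := Order.hasBottom.Build d upclopen upc_le0x.
HB.instance Definition _ := Order.hasTop.Build d upclopen upc_lex1.

End ClopenIncreasingLattice.

(** * The m-lattice of an mq-space *)

Section MQSpaceLattice.
Variables (d : Order.disp_t) (X : POrderedTopological.type d).
Variables (E : X -> X -> Prop) (XE : is_mqspace E).

Definition upc_nab (U : upclopen X) : upclopen X :=
  UpClopen (qspace_image (mqspace_qspace XE) (upcP U)).

Lemma clopen_increasing_tri (V : set X) : clopen_increasing V ->
  clopen_increasing (~` down_closure (rel_image E (~` V))).
Proof.
move=> DV; split; first exact/clopenC/(mq2 XE DV).
by move=> x y xy nx [z Ez yz]; apply: nx; exists z => //; exact: le_trans yz.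
Qed.

Definition upc_tri (U : upclopen X) : upclopen X :=
  UpClopen (clopen_increasing_tri (upcP U)).

(** Condition [mq1] enters in [tri_tri] and [nab_tri]: it turns an E-step followed by an upward step
    into an upward step followed by an E-step, so that longer alternations collapse by transitivity.
    For [tri_nab] the point is that E(U) is increasing and a union of classes. *)
Lemma is_mlattice_upclopen : is_mlattice upc_tri upc_nab.
Proof.
have [rE sE tE] := qspace_equiv (mqspace_qspace XE).
split=> [|U|U V|U V|U||U|U V|U|U|U]; apply: upclopen_eq; apply/seteqP;
  split=> x //=.
- by case.
- by case.
- by move=> Ux; split=> //; exists x.
- move=> [y [Uy [z Vz zy]] yx].
  by split; [exists y|exists z => //; exact: tE yx].
- move=> [[y Uy yx] [z Vz zx]]; exists y => //; split=> //.
  by exists z => //; apply: (tE _ _ _ zx); exact: sE.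
- by move=> [y [Uy|Vy] yx]; [left|right]; exists y.
- by move=> [[y Uy yx]|[y Vy yx]]; exists y => //; [left|right].
- by move=> [y [z Uz zy] yx]; exists z => //; exact: tE yx.
- by move=> Ux; exists x.
- by move=> _ [y [z nz zy] xy]; apply: nz.
- by case.
- move=> nx; split=> //; apply: contrapT => Ux.
  by apply: nx; exists x => //; exists x.
- move=> nx; split=> -[y [z nz zy] xy]; apply: nx; exists y => //;
    by exists z => // -[].
- move=> [nx nx'] [y [z /not_andP[nz|nz] zy] xy]; [apply: nx|apply: nx'];
  by exists y => //; exists z.
- move=> nx y; apply: nx; case: y => y nz xy; exists y => //.
  by exists y => // ny; apply: ny; exists y.
- move=> nx [y [z /contrapT[u [v nv vu] zu] zy] xy]; apply: nx.
  have [w yw wu] := mq1 XE (sE _ _ zy) zu.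
  exists w; last exact: le_trans xy yw.
  by exists v => //; apply: (tE _ _ _ vu); exact: sE.
- move=> [y ny yx] [u [v nv vu] xu]; apply: ny.
  have [w yw wu] := mq1 XE yx xu.
  by exists w => //; exists v => //; apply: (tE _ _ _ vu); exact: sE.
- by move=> nx; exists x.
- by move=> nx; apply: contrapT => Ux; apply: nx; exists x => //; exists x.
- move=> [z Uz zx] [u [v nv vu] xu]; apply: nv.
  have [_ inc] := qspace_image (mqspace_qspace XE) (upcP U).
  have [z' Uz' zu] : rel_image E (upc_set U) u by apply: inc xu _; exists z.
  by exists z' => //; apply: (tE _ _ _ zu); exact: sE.
Qed.

End MQSpaceLattice.

(** * The mq-space of an m-lattice *)

Section PrimeFilterMQSpace.
Variable L : mlattice.
Implicit Types (P Q R S : prime_filter L).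

Lemma nab_le (x y : L) : x <= y -> ml_nab x <= ml_nab y.
Proof.
move=> /join_idPl <-.
by rewrite (nab_join (ml_axioms L)) leUr.
Qed.

Lemma tri_le (x y : L) : x <= y -> ml_tri x <= ml_tri y.
Proof.
move=> /meet_idPl <-.
by rewrite (tri_meet (ml_axioms L)) leIr.
Qed.

Lemma le_nab (x : L) : x <= ml_nab x.
Proof. by apply/meet_idPl; exact: meet_nab (ml_axioms L) x. Qed.

Lemma tri_sub (x : L) : ml_tri x <= x.
Proof. by apply/meet_idPr; exact: meet_tri (ml_axioms L) x. Qed.

(** A meet of two nablas is again a nabla, so a filter generated by nablas can be described with a
    single nabla as generator. *)
Lemma nab_meet_nab (x y : L) :
  ml_nab (ml_nab x `&` ml_nab y)%O = (ml_nab x `&` ml_nab y)%O.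
Proof. by rewrite (nab_meet (ml_axioms L)) (nab_nab (ml_axioms L)). Qed.

Definition pf_rel P Q : Prop :=
  forall a : L, pf_set P (ml_nab a) <-> pf_set Q (ml_nab a).

Lemma pf_rel_refl P : pf_rel P P.
Proof. by []. Qed.

Lemma pf_rel_sym P Q : pf_rel P Q -> pf_rel Q P.
Proof. by move=> PQ a; split=> /PQ. Qed.

Lemma pf_rel_trans P Q R : pf_rel P Q -> pf_rel Q R -> pf_rel P R.
Proof. by move=> PQ QR a; split=> [/PQ/QR|/QR/PQ]. Qed.

(* The prime filter separates the filter generated by F and the nablas in R
   from the ideal generated by the nablas outside R. *)
Lemma pf_rel_extension (F : set L) R : lattice_filter F ->
  (forall p, F p -> pf_set R (ml_nab p)) ->
  exists2 Q, F `<=` pf_set Q & pf_rel Q R.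
Proof.
move=> [F1 Fu Fm] FR; have [[R1 Ru Rm] R0 Rj] := pf_prime R.
pose G := [set x | exists p r,
  [/\ F p, pf_set R (ml_nab r) & (p `&` ml_nab r <= x)%O]].
pose I := [set x | exists2 s, ~ pf_set R (ml_nab s) & x <= ml_nab s].
have Gf : lattice_filter G.
  split.
  - by exists \top, \top; split; rewrite ?lex1 //; exact: FR.
  - by move=> x y xy [p [r [Fp Rr px]]]; exists p, r; split=> //;
      exact: le_trans xy.
  - move=> x y [p [r [Fp Rr px]]] [q [s [Fq Rs qy]]].
    exists (p `&` q)%O, (ml_nab r `&` ml_nab s)%O; rewrite nab_meet_nab.
    split; [exact: Fm|exact: Rm|rewrite lexI].
    by rewrite (le_trans _ px) ?(le_trans _ qy) // leI2 ?leIl ?leIr.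
have Ii : lattice_ideal I.
  split.
  - by exists \bot; rewrite ?(nab0 (ml_axioms L)).
  - by move=> x y xy [s Rs ys]; exists s => //; exact: le_trans ys.
  - move=> x y [s Rs xs] [t Rt yt]; exists (s `|` t)%O;
      rewrite (nab_join (ml_axioms L)); last by rewrite leU2.
    by move=> /Rj[].
have [x [p [r [Fp Rr px]]] [s Rs xs]|P [hP GP PI]] :=
    prime_filter_separation Gf Ii.
  apply: Rs; apply: (Ru (ml_nab p `&` ml_nab r)%O); last exact: Rm (FR _ Fp) Rr.
  rewrite -(nab_meet (ml_axioms L)) -[leRHS](nab_nab (ml_axioms L)).
  by apply: nab_le; exact: le_trans px xs.
exists (PrimeFilter hP) => [p Fp|a] /=.
  by apply: GP; exists p, \top; split; [|exact: FR|exact: leIl].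
split=> [Pa|Ra].
  by apply: contrapT => Ra; apply: (PI _ Pa); exists a.
by apply: GP; exists \top, a; split=> //; exact: leIr.
Qed.

(** If Q contains [ml_nab a], it contains the nabla of everything above a, so the principal filter
    of a extends to a prime filter related to Q. *)
Lemma rel_image_stone (a : L) :
  rel_image pf_rel (stone a) = stone (ml_nab a).
Proof.
apply/seteqP; split=> [Q [P Pa PQ]|Q Qa].
  by apply/(PQ a); exact: pf_up (le_nab a) Pa.
have [||P aP PQ] := @pf_rel_extension [set x | a <= x] Q.
- exact: principal_filter.
- by move=> p ap; apply: pf_up Qa; exact: nab_le.
by exists P => //; exact: aP a (lexx a).
Qed.

(** Left to right, [ml_tri a] is its own nabla and so passes between related prime filters.
    Conversely, let P omit [ml_tri a]. No nabla in P lies below a, since it equals its own [ml_tri]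
    and would lie below [ml_tri a]. Hence some prime R omits a and contains all nablas of P, and the
    extension property yields Q above P in the class of R. *)
Lemma down_closure_stoneC (a : L) :
  down_closure (rel_image pf_rel (~` stone a)) = ~` stone (ml_tri a).
Proof.
apply/seteqP; split=> [P [Q [R Ra RQ] /pf_leP PQ] Pa|P Pa].
  apply: Ra; apply: pf_up (tri_sub a) _.
  rewrite -(nab_tri (ml_axioms L)); apply/RQ.
  by rewrite (nab_tri (ml_axioms L)); exact: PQ.
have [[P1 Pu Pm] _ _] := pf_prime P.
have [||x [b Pb bx] xa|R [hR PR Ra]] :=
  @prime_filter_separation _ L
    [set x | exists2 b, pf_set P (ml_nab b) & ml_nab b <= x]
    [set x | x <= a].
- split.
  + by exists \top; rewrite ?lex1 //; exact: pf_up (le_nab _) P1.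
  + by move=> x y xy [b Pb bx]; exists b => //; exact: le_trans xy.
  + move=> x y [b Pb bx] [c Pc cy].
    exists (ml_nab b `&` ml_nab c)%O; rewrite nab_meet_nab; first exact: Pm.
    by rewrite leI2.
- exact: principal_ideal.
- apply: Pa; apply: pf_up Pb; rewrite -(tri_nab (ml_axioms L)).
  by apply: tri_le; exact: le_trans bx xa.
have [|p Pp|Q PQ QR] := @pf_rel_extension (pf_set P) (PrimeFilter hR).
- by [].
- by apply: PR; exists p => //; exact: pf_up (le_nab p) Pp.
exists Q; last exact/pf_leP.
by exists (PrimeFilter hR); [move=> /Ra; apply=> /=|exact: pf_rel_sym].
Qed.

Lemma is_mqspace_prime_filter : is_mqspace pf_rel.
Proof.
split; first split.
- exact: prime_filter_priestley.
- split; [exact: pf_rel_refl|exact: pf_rel_sym|exact: pf_rel_trans].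
- move=> U /stone_surj[a ->]; rewrite rel_image_stone.
  exact: stone_clopen_increasing.
- move=> P.
  (* The class of P is cut out by one condition for each a, and each condition defines a Stone set
     or the complement of one, hence a closed set. *)
  suff -> : rel_image pf_rel [set P] =
    \bigcap_(a in [set: L])
      [set Q | pf_set P (ml_nab a) <-> pf_set Q (ml_nab a)].
    apply: closed_bigI => a _.
    have [o c] := stone_clopen (ml_nab a).
    have [Pa|Pa] := pselect (pf_set P (ml_nab a)).
      by rewrite (_ : [set Q | _] = stone (ml_nab a)) //;
        apply/seteqP; split=> Q /=; [move=> [+ _]; apply|].
    rewrite (_ : [set Q | _] = ~` stone (ml_nab a)) ?closedC //.
    by apply/seteqP; split=> Q /=; [move=> [_ QP] /QP|].
  apply/seteqP; split=> [Q [_ -> PQ] a _|Q PQ]; first exact: PQ.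
  by exists P => // a; exact: PQ.
- move=> P Q S PQ /pf_leP QS.
  (* For [mq1], P extends into the class of S: p in P puts [ml_nab p] into P, then into Q by the
     relation, then into S by inclusion. *)
  have [|p Pp|W PW WS] := @pf_rel_extension (pf_set P) S.
  + exact: prime_is_filter (pf_prime P).
  + by apply: QS; apply/PQ; exact: pf_up (le_nab p) Pp.
  by exists W => //; exact/pf_leP.
- move=> V /stone_surj[a ->]; rewrite down_closure_stoneC.
  exact/clopenC/stone_clopen.
Qed.

End PrimeFilterMQSpace.

(** * Closed sets in Priestley spaces, and recovering E from the sets E(U) *)

Section Priestley.
Variables (d : Order.disp_t) (X : POrderedTopological.type d).
Hypothesis Xp : is_priestley X.

Lemma priestley_le (x y : X) :
  (forall U, clopen_increasing U -> U x -> U y) -> x <= y.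
Proof.
move=> xy; apply: contrapT => /(priestley_separated Xp)[U [DU Ux nUy]].
exact: nUy (xy U DU Ux).
Qed.

Lemma priestley_up_closed (x : X) : closed [set y | x <= y].
Proof.
rewrite (_ : [set y | _] =
  \bigcap_(U in [set U | clopen_increasing U /\ U x]) U).
  by apply: closed_bigI => U [[[]]].
apply/seteqP; split=> [y xy U [[_ Ui] Ux]|y xy]; first exact: Ui Ux.
by apply: priestley_le => U DU Ux; exact: xy.
Qed.

(** If every clopen increasing set around z met K, compactness would give a point of K in all of
    them, and such a point is above z. *)
Lemma priestley_separate_closed (K : set X) (z : X) :
  closed K -> ~ down_closure K z ->
  exists U, [/\ clopen_increasing U, U z & U `&` K = set0].
Proof.
move=> Kc zK; apply: contrapT => nU; apply: zK.
have [|||U [DU Uz]|y Ky] := @compact_directed X _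
  [set U | clopen_increasing U /\ U z] (fun U => U `&` K)
  (priestley_compact Xp).
- by exists setT; split=> //; exact: clopen_increasingT.
- move=> U V [DU Uz] [DV Vz]; exists (U `&` V); last by move=> x [[]].
  by split=> //; exact: clopen_increasingI.
- by move=> U [[[_ Uc] _] _]; exact: closedI.
- by apply: contrapT => /nonemptyPn UK; apply: nU; exists U.
exists y; first by case: (Ky setT) => //; split=> //; exact: clopen_increasingT.
by apply: priestley_le => U DU Uz; case: (Ky U).
Qed.

Lemma priestley_closed_maximal (K : set X) (x : X) : closed K -> K x ->
  exists2 m, K m & forall y, K y -> m <= y -> y = m.
Proof.
move=> Kc Kx.
have [|||A Atot|[m Km] mmax] := @Zorn {y | K y} (fun y z => sval y <= sval z).
- by [].
- by move=> r s t; exact: le_trans.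
- move=> [s Ks] [t Kt] /= st ts; apply: eq_exist => /=.
  by apply/eqP; rewrite eq_le st.
- have [[a Aa]|A0] := pselect (exists a, A a); last first.
    by exists (exist _ x Kx) => s As; case: A0; exists s.
  (* An upper bound in K of the nonempty chain A is a common point of the directed closed sets
     formed by the elements of K above a member of A. *)
  have [|||i Ai|y Ky] := @compact_directed X _ A
    (fun a => [set y | sval a <= y] `&` K) (priestley_compact Xp).
  + by exists a.
  + move=> i j Ai Aj; have [ij|ji] := Atot i j Ai Aj.
      by exists j => // y [jy Ky]; split; split=> //; exact: le_trans jy.
    by exists i => // y [iy Ky]; split; split=> //; exact: le_trans iy.
  + by move=> i _; apply: closedI => //; exact: priestley_up_closed.
  + by exists (sval i); split; [exact: lexx|exact: svalP].
  by exists (exist _ y (Ky a Aa).2) => s As; case: (Ky s As).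
- exists m => // y Ky my.
  by have := mmax (exist _ y Ky) my => -[].
Qed.

Lemma priestley_hausdorff : hausdorff_space X.
Proof.
rewrite open_hausdorff => x y xy.
wlog nxy : x y xy / ~ x <= y.
  move=> h; have [lxy|] := pselect (x <= y); last exact: h.
  have [||[A B] [/= yA xB] [oA oB AB]] := h y x; first by rewrite eq_sym.
    by move=> lyx; move/eqP: xy; apply; apply/eqP; rewrite eq_le lxy.
  by exists (B, A) => //; split=> //; rewrite setIC.
have [U [[[Uo Uc] _] Ux nUy]] := priestley_separated Xp nxy.
exists (U, ~` U); first by split; rewrite inE.
by split=> //=; [rewrite openC|rewrite setICr].
Qed.

End Priestley.

(* If x and y have the same saturations but different classes, then every
   element of either class is below an element of the other one; a maximal
   element of the class of y then lies in both. *)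
Lemma qspace_rel_separated (d : Order.disp_t) (X : POrderedTopological.type d)
    (E : X -> X -> Prop) (x y : X) : is_qspace E ->
  (forall U, clopen_increasing U -> rel_image E U x <-> rel_image E U y) ->
  E x y.
Proof.
move=> [Xp [rE sE tE] DE clE] xy.
have below u v : (forall U, clopen_increasing U ->
    rel_image E U u -> rel_image E U v) ->
    rel_image E [set u] `<=` down_closure (rel_image E [set v]).
  move=> uv z [_ -> uz]; apply: contrapT.
  move=> /(priestley_separate_closed Xp (clE v))[U [DU Uz UK]].
  have [|w Uw wv] := uv U DU; first by exists z => //; exact: sE.
  suff : (U `&` rel_image E [set v]) w by rewrite UK.
  by split=> //; exists v => //; exact: sE.
have [|m [_ -> ym] mmax] := priestley_closed_maximal Xp (clE y) (x := y).
  by exists y.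
have [|x0 [_ -> xx0] mx0] := below y x (fun U DU => (xy U DU).2) m.
  by exists y.
have [|y1 Ey1 x0y1] := below x y (fun U DU => (xy U DU).1) x0.
  by exists x.
have ym1 : y1 = m by apply: mmax => //; exact: le_trans x0y1.
have mx : x0 = m by apply/eqP; rewrite eq_le mx0 andbT -ym1.
by apply: tE xx0 _; rewrite mx; exact: sE.
Qed.

(** * Points of a Priestley space as prime filters of clopen increasing sets *)

Section Evaluation.
Variables (d : Order.disp_t) (X : POrderedTopological.type d).

Lemma is_prime_filter_eval (x : X) :
  is_prime_filter [set U : upclopen X | upc_set U x].
Proof. by split=> //; split=> // U V /upcleP UV /UV. Qed.

Definition pf_eval (x : X) : prime_filter (upclopen X) :=
  PrimeFilter (is_prime_filter_eval x).

Hypothesis Xp : is_priestley X.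

Lemma pf_eval_le (x y : X) : (pf_eval x <= pf_eval y) = (x <= y).
Proof.
apply/pf_leP/idP => [xy|xy U]; last exact: (upcP U).2 xy.
apply: priestley_le => // U DU; exact: (xy (UpClopen DU)).
Qed.

Lemma pf_eval_inj : injective pf_eval.
Proof. by move=> x y xy; apply/eqP; rewrite eq_le -!pf_eval_le xy lexx. Qed.

(** The differences of a member U of P and a non-member V are nonempty, because P is upward closed,
    and directed, because P is prime. A common point x lies in exactly the members of P. *)
Lemma pf_eval_surj (P : prime_filter (upclopen X)) : exists x, pf_eval x = P.
Proof.
have [[P1 Pu Pm] P0 Pj] := pf_prime P.
have [|||[U V] /= [PU PV]|x xP] := @compact_directed X (upclopen X * upclopen X)
  [set UV | pf_set P UV.1 /\ ~ pf_set P UV.2]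
  (fun UV => upc_set UV.1 `\` upc_set UV.2) (priestley_compact Xp).
- by exists (\top, \bot).
- move=> [U V] [U' V'] /= [PU PV] [PU' PV'].
  exists ((U `&` U')%O, (V `|` V')%O) => /=; last first.
    by move=> x [[Ux U'x] /not_orP[Vx V'x]].
  by split; [exact: Pm|move=> /Pj[]].
- move=> [U V] _; apply: closedI; first exact: (upcP U).1.2.
  by rewrite closedC; exact: (upcP V).1.1.
- apply: contrapT => /nonemptyPn; rewrite setD_eq0 => /upcleP UV.
  exact: PV (Pu _ _ UV PU).
exists x; apply: prime_filter_eq; apply/seteqP; split=> U /= => [Ux|PU].
  (* Pairing with [\top] shows that x avoids the non-members of P; pairing with [\bot] below shows
     that it lies in the members. *)
  by apply: contrapT => PU; have [] := xP (\top, U).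
by have [] := xP (U, \bot).
Qed.

Lemma pf_eval_continuous : continuous pf_eval.
Proof.
apply/continuousP => O oO; rewrite openE => x /oO[U [V [xU xV UVO]]].
apply: (@filterS _ _ _ (upc_set U `\` upc_set V)).
  by move=> y UVy; exact: (UVO (pf_eval y)).
apply: open_nbhs_nbhs; split=> //; apply: openI; first exact: (upcP U).1.1.
by rewrite openC; exact: (upcP V).1.2.
Qed.

Definition pf_point (P : prime_filter (upclopen X)) : X :=
  sval (cid (pf_eval_surj P)).

Lemma pf_pointK : cancel pf_point pf_eval.
Proof. by move=> P; rewrite /pf_point; case: cid. Qed.

Lemma pf_evalK : cancel pf_eval pf_point.
Proof. by move=> x; apply: pf_eval_inj; rewrite pf_pointK. Qed.

(** A continuous map from a compact space to a Hausdorff space is closed, so the inverse of the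
    bijection [pf_eval] is continuous. *)
Lemma pf_point_continuous : continuous pf_point.
Proof.
apply/continuous_closedP => K Kc.
have -> : pf_point @^-1` K = pf_eval @` K.
  apply/seteqP; split=> [P KP|_ [x Kx <-]]; last by rewrite /= pf_evalK.
  by exists (pf_point P) => //; rewrite pf_pointK.
apply: compact_closed.
  exact/priestley_hausdorff/prime_filter_priestley.
apply: continuous_compact.
  by apply: continuous_subspaceT => x; exact: pf_eval_continuous.
exact: subclosed_compact Kc (priestley_compact Xp) _.
Qed.

End Evaluation.

(** * Evaluation as an isomorphism of mq-spaces *)

Definition upclopen_mlattice (X : mqspace) : mlattice :=
  MLattice (is_mlattice_upclopen (mq_axioms X)).

Definition prime_filter_mqspace (L : mlattice) : mqspace :=
  MQSpace (is_mqspace_prime_filter L).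

Lemma mqspace_is_priestley (X : mqspace) : is_priestley X.
Proof. exact: qspace_priestley (mqspace_qspace (mq_axioms X)). Qed.

Lemma pf_rel_eval (X : mqspace) (x y : X) :
  @pf_rel (upclopen_mlattice X) (pf_eval x) (pf_eval y) <-> mq_rel x y.
Proof.
have [_ sE tE] := qspace_equiv (mqspace_qspace (mq_axioms X)).
split=> [xy|xy U] /=.
  apply: qspace_rel_separated (mqspace_qspace (mq_axioms X)) _ => U DU.
  exact: (xy (UpClopen DU)).
split=> -[z Uz zx]; exists z => //; first exact: tE zx xy.
by apply: (tE _ _ _ zx); exact: sE.
Qed.

(** Both image conditions are expressed through E and the order alone, so a bijection that preserves
    and reflects these satisfies them for arbitrary sets. *)
Lemma order_homeo_is_mqfunction (X1 X2 : mqspace) (f : X1 -> X2)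
    (g : X2 -> X1) :
  cancel f g -> cancel g f -> {mono f : x y / x <= y} -> continuous f ->
  (forall x y, mq_rel (f x) (f y) <-> mq_rel x y) ->
  is_mqfunction (@mq_rel X1) (@mq_rel X2) f.
Proof.
move=> fK gK fle fct fE.
have imf (U : set X2) :
    rel_image (@mq_rel X1) (f @^-1` U) = f @^-1` (rel_image (@mq_rel X2) U).
  apply/seteqP; split=> [y [x Ux xy]|y [x Ux xy]] /=.
    by exists (f x) => //; exact/fE.
  by exists (g x); rewrite /= ?gK //; apply/fE; rewrite gK.
split; first split=> //; first by move=> x y; rewrite fle.
move=> V _; rewrite imf; apply/seteqP; split=> [y [x Vx yx]|y [x Vx yx]] /=.
  by exists (f x) => //; rewrite fle.
by exists (g x); rewrite /= ?gK // -fle gK.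
Qed.

Section EvaluationIsomorphism.
Variable X : mqspace.
Let XDX := prime_filter_mqspace (upclopen_mlattice X).
Let Xp := mqspace_is_priestley X.

Lemma is_mqfunction_eval :
  is_mqfunction (@mq_rel X) (@mq_rel XDX) (@pf_eval _ X).
Proof.
apply: (@order_homeo_is_mqfunction X XDX _ _ (pf_evalK Xp) (pf_pointK Xp)).
- exact: pf_eval_le.
- exact: pf_eval_continuous.
- exact: pf_rel_eval.
Qed.

Lemma is_mqfunction_point :
  is_mqfunction (@mq_rel XDX) (@mq_rel X) (pf_point Xp).
Proof.
apply: (@order_homeo_is_mqfunction XDX X _ _ (pf_pointK Xp) (pf_evalK Xp)).
- by move=> P Q; rewrite -(pf_eval_le Xp) !pf_pointK.
- exact: pf_point_continuous.
- by move=> P Q; rewrite -pf_rel_eval !pf_pointK.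
Qed.

Definition mqspace_eval : mqfunction X XDX := MQFunction is_mqfunction_eval.
Definition mqspace_point : mqfunction XDX X := MQFunction is_mqfunction_point.

End EvaluationIsomorphism.

(** * Action of the two constructions on morphisms *)

Section UpclopenFunctor.
Variables (X1 X2 : mqspace) (f : mqfunction X1 X2).

Definition upc_preimage (U : upclopen X2) : upclopen X1 :=
  UpClopen (clopen_increasing_preimage
    (qfun_monotone (mqfun_qfun (mqfun_axioms f)))
    (qfun_continuous (mqfun_qfun (mqfun_axioms f))) (upcP U)).

(** Preimages commute with the lattice operations; the two image conditions on an mq-function amount
    to preservation of nabla and, after complementation, of triangle. *)
Lemma is_mlattice_hom_preimage :
  @is_mlattice_hom (upclopen_mlattice X2) (upclopen_mlattice X1) upc_preimage.
Proof.
split=> [U V|U V|||U|U]; apply: upclopen_eq => //=.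
  have := mqfun_down (mqfun_axioms f) (upcP U).
  by rewrite -preimage_setC => ->.
by rewrite (qfun_image (mqfun_qfun (mqfun_axioms f)) (upcP U)).
Qed.

Definition upclopen_map :
    mlattice_hom (upclopen_mlattice X2) (upclopen_mlattice X1) :=
  MLatticeHom is_mlattice_hom_preimage.

End UpclopenFunctor.

Section PrimeFilterFunctor.
Variables (L1 L2 : mlattice) (h : mlattice_hom L1 L2).

Lemma is_prime_filter_preimage (P : prime_filter L2) :
  is_prime_filter (h @^-1` pf_set P).
Proof.
have [hI hU h0 h1 _ _] := mlhom_axioms h.
have [[P1 Pu Pm] P0 Pj] := pf_prime P.
split; first split.
- by rewrite /= h1.
- move=> x y /meet_idPl xy; apply: Pu; apply/meet_idPl.
  by rewrite -hI xy.
- by move=> x y Px Py; rewrite /= hI; exact: Pm.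
- by rewrite /= h0.
- by move=> x y /=; rewrite hU; exact: Pj.
Qed.

Definition pf_preimage (P : prime_filter L2) : prime_filter L1 :=
  PrimeFilter (is_prime_filter_preimage P).

Lemma pf_preimage_stone (a : L1) : pf_preimage @^-1` stone a = stone (h a).
Proof. by []. Qed.

(** Every clopen increasing set is a Stone set, so the image conditions reduce to h commuting with
    nabla and triangle. *)
Lemma is_mqfunction_pf_preimage :
  is_mqfunction (@pf_rel L2) (@pf_rel L1) pf_preimage.
Proof.
have [hI hU h0 h1 ht hn] := mlhom_axioms h.
split; first split.
- by move=> P Q /pf_leP PQ; apply/pf_leP => a; exact: PQ.
- apply/continuousP => O oO; rewrite pf_openE => P /oO[a [b [Pa Pb abO]]].
  by exists (h a), (h b); split=> // Q Qab; exact: abO.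
- move=> U /stone_surj[a ->].
  by rewrite pf_preimage_stone !rel_image_stone pf_preimage_stone hn.
- move=> V /stone_surj[a ->]; rewrite -preimage_setC pf_preimage_stone.
  by rewrite !down_closure_stoneC -preimage_setC pf_preimage_stone ht.
Qed.

Definition prime_filter_map :
    mqfunction (prime_filter_mqspace L2) (prime_filter_mqspace L1) :=
  @MQFunction (prime_filter_mqspace L2) (prime_filter_mqspace L1)
    pf_preimage is_mqfunction_pf_preimage.

End PrimeFilterFunctor.

(** * The Stone isomorphism of m-lattices *)

Section StoneIsomorphism.
Variable L : mlattice.

Definition upc_stone (a : L) : upclopen (prime_filter L) :=
  UpClopen (stone_clopen_increasing a).

Lemma upc_stone_inj : injective upc_stone.
Proof.
move=> a b [ab]; apply/eqP; rewrite eq_le.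
by apply/andP; split; apply: stone_le; rewrite ab.
Qed.

Lemma upc_stone_surj (U : upclopen (prime_filter L)) :
  exists a, upc_stone a = U.
Proof.
by have [a Ua] := stone_surj (upcP U); exists a; apply: upclopen_eq; rewrite Ua.
Qed.

Lemma is_mlattice_hom_stone :
  @is_mlattice_hom L (upclopen_mlattice (prime_filter_mqspace L)) upc_stone.
Proof.
split=> [a b|a b|||a|a]; apply: upclopen_eq => /=.
- exact: stoneI.
- exact: stoneU.
- exact: stone0.
- exact: stone1.
- by rewrite down_closure_stoneC setCK.
- by rewrite rel_image_stone.
Qed.

Definition stone_hom :
    mlattice_hom L (upclopen_mlattice (prime_filter_mqspace L)) :=
  MLatticeHom is_mlattice_hom_stone.

End StoneIsomorphism.

Lemma bijective_mlattice_hom_inverse (L1 L2 : mlattice)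
    (h : mlattice_hom L1 L2) :
  injective h -> (forall y, exists x, h x = y) ->
  exists g : mlattice_hom L2 L1, cancel h g /\ cancel g h.
Proof.
move=> hinj hsurj; pose g y := sval (cid (hsurj y)).
have gK : cancel g h by move=> y; rewrite /g; case: cid.
have hK : cancel h g by move=> x; apply: hinj; rewrite gK.
have [hI hU h0 h1 ht hn] := mlhom_axioms h.
have gh : is_mlattice_hom g.
  by split=> [x y|x y|||x|x]; apply: hinj;
    rewrite ?(hI, hU, h0, h1, ht, hn) !gK.
by exists (MLatticeHom gh).
Qed.

(** * The functors and the natural isomorphisms *)

Lemma naturally_isomorphic_sym (C D : category) (F G : functor C D) :
  naturally_isomorphic F G -> naturally_isomorphic G F.
Proof.
move=> [eta [nat iso]].
pose inv a := sval (cid (iso a)).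
have invl a : comp (inv a) (eta a) = idm (F a) := (svalP (cid (iso a))).1.
have invr a : comp (eta a) (inv a) = idm (G a) := (svalP (cid (iso a))).2.
exists inv; split=> [a b f|a]; last by exists (eta a).
rewrite -[fmap G f]comp_idr -invr (comp_assoc (fmap G f)) -nat.
by rewrite !comp_assoc invl comp_idl.
Qed.

(** Closed transparently, like the next functor, so that the object and arrow maps unfold in the
    naturality squares. *)
Definition upclopen_functor : functor mQ (dual_category M).
Proof.
refine (@Functor mQ (dual_category M) upclopen_mlattice upclopen_map _ _).
- by move=> X; apply: mlattice_hom_eq; apply/funext => U; apply: upclopen_eq.
- move=> X Y Z g f.
  by apply: mlattice_hom_eq; apply/funext => U; apply: upclopen_eq.
Defined.

Definition prime_filter_functor : functor (dual_category M) mQ.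
Proof.
refine (@Functor (dual_category M) mQ prime_filter_mqspace
  (fun L1 L2 h => @prime_filter_map L2 L1 h) _ _).
- by move=> L; apply: mqfunction_eq; apply/funext => P; apply: prime_filter_eq.
- move=> L1 L2 L3 g f.
  by apply: mqfunction_eq; apply/funext => P; apply: prime_filter_eq.
Defined.

Theorem theorem2p1 : equivalent_categories mQ (dual_category M).
Proof.
exists upclopen_functor, prime_filter_functor; split.
  (* Evaluation goes from the identity to the composite, opposite to the required direction. *)
  apply: naturally_isomorphic_sym; exists mqspace_eval; split=> [X Y f|X].
    by apply: mqfunction_eq; apply/funext => x; apply: prime_filter_eq.
  exists (mqspace_point X); split; apply: mqfunction_eq; apply/funext => x.
    exact: pf_evalK.
  exact: pf_pointK.
(* No reversal here: in the dual category a homomorphism out of L is already an arrow into L. *)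
exists stone_hom; split=> [L1 L2 h|L].
  by apply: mlattice_hom_eq; apply/funext => a; apply: upclopen_eq.
have [g [hK gK]] := bijective_mlattice_hom_inverse
  (h := stone_hom L) (@upc_stone_inj L) (@upc_stone_surj L).
by exists g; split; apply: mlattice_hom_eq; apply/funext => x;
  [exact: gK|exact: hK].
Qed.
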